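(* (1) Two pure quaternions $\theta,\eta$ are twins if and only if $(\theta,\eta)$ is parameterized by a pair $(\alpha,z)\in\mathbb{E}\times\mathbb{G}$ with $\alpha\neq0$, $z\neq0$. (2) Every pair in $\mathbb{E}\times\mathbb{G}$ is equivalent to a pair whose second component is squarefree in $\mathbb{G}$. (3) Let $(\alpha_1,z_1),(\alpha_2,z_2)\in\mathbb{E}\times\mathbb{G}$ with $z_1,z_2$ squarefree in $\mathbb{G}$. These pairs are equivalent if and only if there is a unit $\rho\in\{\pm1,\pm i\}$ of $\mathbb{G}$ with $\alpha_2=\alpha_1\rho$ and $z_2=\rho^2z_1$. (4) The common length of twins $\theta,\eta$ is an integer if and only if in a parameterization $(\alpha,z)\in\mathbb{E}\times\mathbb{G}$ of $(\theta,\eta)$ with $z$ squarefree, $z$ is either real or purely imaginary.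
   Context: $\mathbb{E}$ is the ring of Hurwitz integral quaternions (quaternions $a+bi+cj+dk$ with $a,b,c,d$ all integers or all halves of odd integers); $\mathbb{G}=\mathbb{Z}[i]\subset\mathbb{E}$ is the ring of Gaussian integers, and squarefree in $\mathbb{G}$ means not divisible by the square of any Gaussian prime. $\overline{\alpha}$ denotes quaternion conjugation, $N(\alpha)=\alpha\overline{\alpha}$; a quaternion is pure if its real part is $0$. A vector $(v_1,v_2,v_3)$ is identified with $v_1i+v_2j+v_3k$. Two pure quaternions $\theta,\eta$ are twins if they correspond to twin vectors: nonzero orthogonal vectors in $\mathbb{Z}^3$ of equal length (equivalently: $\theta,\eta$ nonzero pure with integer coefficients, $N(\theta)=N(\eta)$, and $\theta\eta$ pure). A pair $(\theta,\eta)$ is parameterized by $(\alpha,z)$ (quaternion $\alpha$, complex $z$) if $\theta=\alpha zj\overline{\alpha}$ and $\eta=\alpha zk\overline{\alpha}$; two pairs $(\alpha_1,z_1),(\alpha_2,z_2)$ are equivalent if they parameterize the same $(\theta,\eta)$.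
   Formalization: In (3) the case α₁ = α₂ = 0 is excluded, since the claim fails there: (0,1) and (0,i) both parameterize (0,0), but no unit ρ in {±1, ±i} satisfies ρ² = i. *)

(* Defs.v *)
From HB Require Import structures.
From mathcomp Require Import all_boot all_order all_algebra.
From mathcomp Require Import reals.
From mathcomp Require Import ring.

Set Implicit Arguments.
Unset Strict Implicit.
Unset Printing Implicit Defensive.

Import Order.TTheory GRing.Theory Num.Theory.

Local Open Scope ring_scope.

(* [Quat a b c d] is a + bi + cj + dk. *)
Record quat (R : Type) := Quat { q0 : R; q1 : R; q2 : R; q3 : R }.

Section QuatEncoding.
Variable R : Type.

Definition quat_to_prod (x : quat R) : R * R * R * R :=
  (q0 x, q1 x, q2 x, q3 x).
Definition quat_of_prod (p : R * R * R * R) : quat R :=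
  let: (a, b, c, d) := p in Quat a b c d.

Lemma quat_to_prodK : cancel quat_to_prod quat_of_prod.
Proof. by case. Qed.
End QuatEncoding.

HB.instance Definition _ (R : eqType) :=
  Equality.copy (quat R) (can_type (@quat_to_prodK R)).
HB.instance Definition _ (R : choiceType) :=
  Choice.copy (quat R) (can_type (@quat_to_prodK R)).

Section QuatRing.
Variable R : comNzRingType.
Implicit Types x y z : quat R.

Definition qzero : quat R := Quat 0 0 0 0.
Definition qone : quat R := Quat 1 0 0 0.
Definition qopp x : quat R := Quat (- q0 x) (- q1 x) (- q2 x) (- q3 x).
Definition qadd x y : quat R :=
  Quat (q0 x + q0 y) (q1 x + q1 y) (q2 x + q2 y) (q3 x + q3 y).
Definition qmul x y : quat R :=
  Quat (q0 x * q0 y - q1 x * q1 y - q2 x * q2 y - q3 x * q3 y)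
       (q0 x * q1 y + q1 x * q0 y + q2 x * q3 y - q3 x * q2 y)
       (q0 x * q2 y - q1 x * q3 y + q2 x * q0 y + q3 x * q1 y)
       (q0 x * q3 y + q1 x * q2 y - q2 x * q1 y + q3 x * q0 y).

Lemma qaddA : associative qadd.
Proof. by move=> x y z; rewrite /qadd /=; congr Quat; ring. Qed.
Lemma qaddC : commutative qadd.
Proof. by move=> x y; rewrite /qadd /=; congr Quat; ring. Qed.
Lemma qadd0 : left_id qzero qadd.
Proof. by case=> a b c d; rewrite /qadd /=; congr Quat; ring. Qed.
Lemma qaddN : left_inverse qzero qopp qadd.
Proof. by move=> x; rewrite /qadd /qzero /=; congr Quat; ring. Qed.

HB.instance Definition _ :=
  GRing.isZmodule.Build (quat R) qaddA qaddC qadd0 qaddN.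

Lemma qmulA : associative qmul.
Proof. by move=> x y z; rewrite /qmul /=; congr Quat; ring. Qed.
Lemma qmul1 : left_id qone qmul.
Proof. by case=> a b c d; rewrite /qmul /=; congr Quat; ring. Qed.
Lemma qmulr1 : right_id qone qmul.
Proof. by case=> a b c d; rewrite /qmul /=; congr Quat; ring. Qed.
Lemma qmulDl : left_distributive qmul qadd.
Proof. by move=> x y z; rewrite /qmul /qadd /=; congr Quat; ring. Qed.
Lemma qmulDr : right_distributive qmul qadd.
Proof. by move=> x y z; rewrite /qmul /qadd /=; congr Quat; ring. Qed.
Lemma qone_neq0 : qone != qzero.
Proof. by apply/eqP => -[/eqP]; rewrite oner_eq0. Qed.

HB.instance Definition _ := GRing.Zmodule_isNzRing.Build (quat R)
  qmulA qmul1 qmulr1 qmulDl qmulDr qone_neq0.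

Definition qi : quat R := Quat 0 1 0 0.
Definition qj : quat R := Quat 0 0 1 0.
Definition qk : quat R := Quat 0 0 0 1.

Definition qconj x : quat R := Quat (q0 x) (- q1 x) (- q2 x) (- q3 x).

Definition pure x : Prop := q0 x = 0.

Definition qvec x : 'rV[R]_3 :=
  \row_(i < 3) [:: q1 x; q2 x; q3 x]`_i.

Definition dotv (v w : 'rV[R]_3) : R := \sum_(i < 3) v 0 i * w 0 i.

End QuatRing.

Arguments qi {R}.
Arguments qj {R}.
Arguments qk {R}.

Section Twins.
Variable R : realType.
Implicit Types (x y z a b p theta eta alpha : quat R) (v w : 'rV[R]_3).

Definition lenv v : R := Num.sqrt (dotv v v).

Definition twin_vectors v w : Prop :=
  [/\ v \is a mxOver Num.int /\ w \is a mxOver Num.int,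
      v != 0 /\ w != 0, dotv v w = 0 & lenv v = lenv w].

Definition twins theta eta : Prop :=
  [/\ pure theta, pure eta & twin_vectors (qvec theta) (qvec eta)].

Definition half_odd (r : R) : Prop :=
  exists n : int, r = (2 * n + 1)%:~R / 2.

Definition hurwitz x : Prop :=
  [/\ q0 x \is a Num.int, q1 x \is a Num.int,
      q2 x \is a Num.int & q3 x \is a Num.int] \/
  [/\ half_odd (q0 x), half_odd (q1 x), half_odd (q2 x) & half_odd (q3 x)].

(* Complex numbers are the quaternions whose j- and k-coordinates vanish. *)
Definition gaussian x : Prop :=
  [/\ q0 x \is a Num.int, q1 x \is a Num.int, q2 x = 0 & q3 x = 0].

Definition gdvd a b : Prop := exists2 c, gaussian c & b = a * c.

Definition gaussian_prime p : Prop :=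
  [/\ gaussian p, p != 0, ~ gdvd p 1 &
      forall a b, gaussian a -> gaussian b ->
        gdvd p (a * b) -> gdvd p a \/ gdvd p b].

Definition gaussian_squarefree z : Prop :=
  forall p, gaussian_prime p -> ~ gdvd (p ^+ 2) z.

Definition real_quat x : Prop := [/\ q1 x = 0, q2 x = 0 & q3 x = 0].
Definition imaginary_quat x : Prop := [/\ q0 x = 0, q2 x = 0 & q3 x = 0].

Definition parameterized theta eta alpha z : Prop :=
  theta = alpha * z * qj * qconj alpha /\ eta = alpha * z * qk * qconj alpha.

Definition equivalent alpha1 z1 alpha2 z2 : Prop :=
  forall theta eta,
    parameterized theta eta alpha1 z1 <-> parameterized theta eta alpha2 z2.

End Twins.

(* Main.v *)
(** Write [theta = twin_j alpha z] and [eta = twin_k alpha z].  For a Gaussian [x],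
    [twin_j (alpha x) z = twin_j alpha (x^2 z)], so square factors of [z] can be moved
    into [alpha], which gives (2).

    Given twins of norm [n], every nonzero [beta] with [theta eta beta = n beta i] satisfies
    [conj beta * theta * beta = w j] and [conj beta * eta * beta = w k] with [w] Gaussian,
    so the twins are [twin_j beta w / m] and [twin_k beta w / m] with [m = N(beta)^2].
    The primes [p] of the denominator [m] are then removed one at a time.  For odd [p],
    let [g = gcd(w, p)]: both [twin_j (beta g) 1] and [twin_k (beta g) 1] vanish mod [p],
    and their coordinates show that this forces [p] to divide [beta g].  For [p = 2]
    a comparison of norms shows that [2] divides [w] or [1 + i] divides [beta] on the
    right; here half-integral coordinates are indispensable.

    For (3), [conj alpha2 * alpha1] commutes with [i] up to a real factor, hence is a
    Gaussian integer [g], and [g^2 z1 = N(alpha2)^2 z2] with [z1], [z2] squarefree makes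
    [g / N(alpha2)] a unit.  The same argument applied to [z^2 conj z = N(z) z] shows that
    a squarefree [z] of square norm is a unit times an integer, which is (4). *)
Require Import Defs.
From HB Require Import structures.
From mathcomp Require Import all_boot all_order all_algebra.
From mathcomp Require Import reals boolp.
From mathcomp Require Import ring lra zify.
Set Implicit Arguments.
Unset Strict Implicit.
Unset Printing Implicit Defensive.

Import Order.TTheory GRing.Theory Num.Theory.
Local Open Scope ring_scope.

(** * Complex numbers and quaternions over a commutative ring *)

Record cplx (R : Type) := Cplx { cre : R; cim : R }.

Section CplxEncoding.
Variable R : Type.
Definition cplx_to_prod (x : cplx R) : R * R := (cre x, cim x).
Definition cplx_of_prod (p : R * R) : cplx R := Cplx p.1 p.2.
Lemma cplx_to_prodK : cancel cplx_to_prod cplx_of_prod.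
Proof. by case. Qed.
End CplxEncoding.

HB.instance Definition _ (R : eqType) :=
  Equality.copy (cplx R) (can_type (@cplx_to_prodK R)).
HB.instance Definition _ (R : choiceType) :=
  Choice.copy (cplx R) (can_type (@cplx_to_prodK R)).

Section CplxRing.
Variable R : comNzRingType.
Implicit Types x y z : cplx R.

Definition czero : cplx R := Cplx 0 0.
Definition cone : cplx R := Cplx 1 0.
Definition copp x : cplx R := Cplx (- cre x) (- cim x).
Definition cadd x y : cplx R := Cplx (cre x + cre y) (cim x + cim y).
Definition cmul x y : cplx R :=
  Cplx (cre x * cre y - cim x * cim y) (cre x * cim y + cim x * cre y).

Lemma caddA : associative cadd.
Proof. by move=> x y z; rewrite /cadd /=; congr Cplx; ring. Qed.
Lemma caddC : commutative cadd.
Proof. by move=> x y; rewrite /cadd /=; congr Cplx; ring. Qed.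
Lemma cadd0 : left_id czero cadd.
Proof. by case=> a b; rewrite /cadd /=; congr Cplx; ring. Qed.
Lemma caddN : left_inverse czero copp cadd.
Proof. by move=> x; rewrite /cadd /czero /=; congr Cplx; ring. Qed.

HB.instance Definition _ :=
  GRing.isZmodule.Build (cplx R) caddA caddC cadd0 caddN.

Lemma cmulA : associative cmul.
Proof. by move=> x y z; rewrite /cmul /=; congr Cplx; ring. Qed.
Lemma cmulC : commutative cmul.
Proof. by move=> x y; rewrite /cmul /=; congr Cplx; ring. Qed.
Lemma cmul1 : left_id cone cmul.
Proof. by case=> a b; rewrite /cmul /=; congr Cplx; ring. Qed.
Lemma cmulDl : left_distributive cmul cadd.
Proof. by move=> x y z; rewrite /cmul /cadd /=; congr Cplx; ring. Qed.
Lemma cone_neq0 : cone != czero.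
Proof. by apply/eqP => -[/eqP]; rewrite oner_eq0. Qed.

HB.instance Definition _ := GRing.Zmodule_isComNzRing.Build (cplx R)
  cmulA cmulC cmul1 cmulDl cone_neq0.

Definition cconj x : cplx R := Cplx (cre x) (- cim x).
Definition creal (c : R) : cplx R := Cplx c 0.
Definition cnorm x : R := cre x ^+ 2 + cim x ^+ 2.

(** Complex numbers have a commutative type of their own, so that [ring] applies to them; this
    embeds them in the quaternions. *)
Definition qcplx x : quat R := Quat (cre x) (cim x) 0 0.
Definition qscal (c : R) : quat R := Quat c 0 0 0.
Definition qnorm (a : quat R) : R :=
  q0 a ^+ 2 + q1 a ^+ 2 + q2 a ^+ 2 + q3 a ^+ 2.
Definition twin_j (a : quat R) (z : cplx R) := a * qcplx z * qj * qconj a.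
Definition twin_k (a : quat R) (z : cplx R) := a * qcplx z * qk * qconj a.

Lemma cplxP x y : cre x = cre y -> cim x = cim y -> x = y.
Proof. by case: x y => [? ?] [? ?] /= -> ->. Qed.

Lemma CplxE (a b c d : R) :
  (Cplx a b * Cplx c d = Cplx (a * c - b * d) (a * d + b * c))
  * (Cplx a b + Cplx c d = Cplx (a + c) (b + d)).
Proof. by []. Qed.
Lemma Cplx10 : (1 = Cplx 1 0 :> cplx R) * (0 = Cplx 0 0 :> cplx R).
Proof. by []. Qed.

Lemma QuatE (a b c d a' b' c' d' : R) :
  (Quat a b c d * Quat a' b' c' d' =
     Quat (a * a' - b * b' - c * c' - d * d')
          (a * b' + b * a' + c * d' - d * c')
          (a * c' - b * d' + c * a' + d * b')
          (a * d' + b * c' - c * b' + d * a'))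
  * (Quat a b c d + Quat a' b' c' d' = Quat (a + a') (b + b') (c + c') (d + d')).
Proof. by []. Qed.
Lemma QuatN (a b c d : R) : - Quat a b c d = Quat (- a) (- b) (- c) (- d).
Proof. by []. Qed.
Lemma Quat10 : (1 = Quat 1 0 0 0 :> quat R) * (0 = Quat 0 0 0 0 :> quat R).
Proof. by []. Qed.

Lemma cconjM x y : cconj (x * y) = cconj x * cconj y.
Proof. by case: x y => [? ?] [? ?]; rewrite /cconj ?CplxE /=; congr Cplx; ring. Qed.
Lemma cconjK : involutive cconj.
Proof. by case=> a b; rewrite /cconj /= opprK. Qed.
Lemma mulccconj x : x * cconj x = creal (cnorm x).
Proof. by case: x => a b; rewrite /cconj /creal /cnorm ?CplxE /=; congr Cplx; ring. Qed.
Lemma cnormM x y : cnorm (x * y) = cnorm x * cnorm y.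
Proof. by case: x y => [? ?] [? ?]; rewrite ?CplxE /cnorm /=; ring. Qed.
Lemma cnorm_conj x : cnorm (cconj x) = cnorm x.
Proof. by rewrite /cnorm /= sqrrN. Qed.
Lemma crealM (a b : R) : creal (a * b) = creal a * creal b.
Proof. by rewrite /creal CplxE; congr Cplx; ring. Qed.

Lemma qcplxM x y : qcplx (x * y) = qcplx x * qcplx y.
Proof. by case: x y => [? ?] [? ?]; rewrite /qcplx CplxE QuatE /=; congr Quat; ring. Qed.
Lemma qcplxD x y : qcplx (x + y) = qcplx x + qcplx y.
Proof. by case: x y => [? ?] [? ?]; rewrite /qcplx CplxE QuatE /=; congr Quat; ring. Qed.
Lemma qcplx_inj : injective qcplx.
Proof. by case=> [? ?] [? ?] [-> ->]. Qed.
Lemma qconjM (a b : quat R) : qconj (a * b) = qconj b * qconj a.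
Proof.
by case: a b => [? ? ? ?] [? ? ? ?]; rewrite QuatE /qconj /= QuatE; congr Quat; ring.
Qed.
Lemma qconjK : involutive (@qconj R).
Proof. by case=> ? ? ? ?; rewrite /qconj /= !opprK. Qed.
Lemma qconj_cplx x : qconj (qcplx x) = qcplx (cconj x).
Proof. by rewrite /qconj /qcplx /= oppr0. Qed.
Lemma qcplx_j x : qcplx x * qj = qj * qcplx (cconj x).
Proof. by case: x => ? ?; rewrite /qcplx /qj QuatE /= QuatE; congr Quat; ring. Qed.
Lemma qcplx_k x : qcplx x * qk = qk * qcplx (cconj x).
Proof. by case: x => ? ?; rewrite /qcplx /qk QuatE /= QuatE; congr Quat; ring. Qed.
Lemma qscalC (c : R) (a : quat R) : qscal c * a = a * qscal c.
Proof. by case: a => ? ? ? ?; rewrite /qscal QuatE /= QuatE; congr Quat; ring. Qed.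
Lemma qscalM (c d : R) : qscal (c * d) = qscal c * qscal d.
Proof. by rewrite /qscal QuatE /=; congr Quat; ring. Qed.
Lemma qcplx_real (c : R) : qcplx (creal c) = qscal c.
Proof. by []. Qed.
Lemma mulqconj (a : quat R) : a * qconj a = qscal (qnorm a).
Proof.
by case: a => ? ? ? ?; rewrite /qconj /qscal /qnorm QuatE /=; congr Quat; ring.
Qed.
Lemma mulqconjl (a : quat R) : qconj a * a = qscal (qnorm a).
Proof.
by case: a => ? ? ? ?; rewrite /qconj /qscal /qnorm QuatE /=; congr Quat; ring.
Qed.
Lemma qnormM (a b : quat R) : qnorm (a * b) = qnorm a * qnorm b.
Proof.
by case: a b => [? ? ? ?] [? ? ? ?]; rewrite QuatE /qnorm /=; ring.
Qed.
Lemma qnorm_conj (a : quat R) : qnorm (qconj a) = qnorm a.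
Proof. by rewrite /qnorm /= !sqrrN. Qed.
Lemma qnorm_cplx x : qnorm (qcplx x) = cnorm x.
Proof. by rewrite /qnorm /cnorm /=; ring. Qed.

(** Moving the conjugate of [x] leftwards past [qj] turns it back into [x], so the two outer factors
    combine into [x * x]. *)
Lemma twin_j_mul a x z : twin_j (a * qcplx x) z = twin_j a (x * x * z).
Proof.
rewrite /twin_j qconjM qconj_cplx -!mulrA; congr (_ * _).
by rewrite (mulrA qj) -qcplx_j !mulrA -!qcplxM (mulrAC x).
Qed.
Lemma twin_k_mul a x z : twin_k (a * qcplx x) z = twin_k a (x * x * z).
Proof.
rewrite /twin_k qconjM qconj_cplx -!mulrA; congr (_ * _).
by rewrite (mulrA qk) -qcplx_k !mulrA -!qcplxM (mulrAC x).
Qed.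
Lemma twin_j_scal a c z : twin_j a (creal c * z) = qscal c * twin_j a z.
Proof. by rewrite /twin_j qcplxM qcplx_real !mulrA qscalC. Qed.
Lemma twin_k_scal a c z : twin_k a (creal c * z) = qscal c * twin_k a z.
Proof. by rewrite /twin_k qcplxM qcplx_real !mulrA qscalC. Qed.
Lemma twin_jD a y z : twin_j a (y + z) = twin_j a y + twin_j a z.
Proof. by rewrite /twin_j qcplxD mulrDr !mulrDl. Qed.
(** Since [i j = k], facts about [twin_k] follow from facts about [twin_j] at all complex
    parameters. *)
Lemma twin_j_i a z : twin_j a (Cplx 0 1 * z) = twin_k a z.
Proof.
rewrite /twin_j /twin_k mulrC qcplxM -!mulrA; do 2!congr (_ * _).
by rewrite mulrA; congr (_ * _); rewrite /qcplx /qj QuatE; congr Quat => /=; ring.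
Qed.
Lemma twin_j_mulE a x z :
  twin_j a (x * z) = qscal (cre x) * twin_j a z + qscal (cim x) * twin_k a z.
Proof.
have {1}-> : x = creal (cre x) + creal (cim x) * Cplx 0 1.
  by case: x => ? ?; rewrite /creal !CplxE /=; congr Cplx; ring.
by rewrite mulrDl -mulrA twin_jD !twin_j_scal twin_j_i.
Qed.
Lemma twin_jE a z :
  twin_j a z = qscal (cre z) * twin_j a 1 + qscal (cim z) * twin_k a 1.
Proof. by rewrite -twin_j_mulE mulr1. Qed.
Lemma twin_j1E a : twin_j a 1 =
  Quat 0 (2 * (q1 a * q2 a - q0 a * q3 a))
    (q0 a ^+ 2 - q1 a ^+ 2 + q2 a ^+ 2 - q3 a ^+ 2)
    (2 * (q0 a * q1 a + q2 a * q3 a)).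
Proof.
case: a => ? ? ? ?.
by rewrite /twin_j Cplx10 /qcplx /qj /qconj /= !QuatE; congr Quat => /=; ring.
Qed.
Lemma twin_k1E a : twin_k a 1 =
  Quat 0 (2 * (q0 a * q2 a + q1 a * q3 a))
    (2 * (q2 a * q3 a - q0 a * q1 a))
    (q0 a ^+ 2 - q1 a ^+ 2 - q2 a ^+ 2 + q3 a ^+ 2).
Proof.
case: a => ? ? ? ?.
by rewrite /twin_k Cplx10 /qcplx /qk /qconj /= !QuatE; congr Quat => /=; ring.
Qed.
Lemma qnorm_twj a z : qnorm (twin_j a z) = qnorm a ^+ 2 * cnorm z.
Proof.
rewrite /twin_j !qnormM qnorm_cplx qnorm_conj; set n := qnorm a.
by rewrite /qnorm /=; ring.
Qed.
Lemma qnorm_twk a z : qnorm (twin_k a z) = qnorm a ^+ 2 * cnorm z.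
Proof.
rewrite /twin_k !qnormM qnorm_cplx qnorm_conj; set n := qnorm a.
by rewrite /qnorm /=; ring.
Qed.
End CplxRing.

(** * Gaussian integers: division, Bezout, squarefreeness, primes *)

Notation gint := (cplx int).

Section GaussianIntegers.
Implicit Types x y z u v d : gint.

Lemma cnorm_ge0 x : 0 <= cnorm x.
Proof. by rewrite /cnorm addr_ge0 // sqr_ge0. Qed.

Lemma cnorm_eq0 x : (cnorm x == 0) = (x == 0).
Proof.
apply/eqP/eqP => [|->]; last by rewrite /cnorm /= expr0n.
case: x => a b; rewrite /cnorm /= => /eqP.
by rewrite paddr_eq0 ?sqr_ge0 // !sqrf_eq0 => /andP[/eqP-> /eqP->].
Qed.

Lemma cnorm_gt0 x : (0 < cnorm x) = (x != 0).
Proof. by rewrite lt0r cnorm_ge0 andbT cnorm_eq0. Qed.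

Lemma cnorm1 : cnorm (1 : gint) = 1.
Proof. by []. Qed.

Lemma gmulI x y z : x != 0 -> x * y = x * z -> y = z.
Proof.
move=> x0 /eqP; rewrite -subr_eq0 -mulrBr -cnorm_eq0 cnormM mulf_eq0.
by rewrite !cnorm_eq0 (negPf x0) subr_eq0 => /eqP.
Qed.

Lemma gmul_neq0 x y : x != 0 -> y != 0 -> x * y != 0.
Proof. by move=> x0 y0; rewrite -cnorm_eq0 cnormM mulf_neq0 // cnorm_eq0. Qed.

Lemma nearest_multiple (a n : int) : 0 < n ->
  exists q, `|2 * (a - q * n)| <= n.
Proof.
(* The floor of [a / n + 1 / 2], that is, [a / n] rounded to a nearest integer. *)
move=> n0; exists ((2 * a + n) %/ (2 * n))%Z.
have := divz_eq (2 * a + n) (2 * n).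
have := modz_ge0 (2 * a + n) (d := 2 * n).
have := ltz_pmod (2 * a + n) (d := 2 * n).
set q := divz _ _; set r := modz _ _ => /(_ ltac:(lia)) h1 /(_ ltac:(lia)) h2 e.
have -> : 2 * (a - q * n) = r - n by lia.
lia.
Qed.

(** Both coordinates of [x * cconj y / cnorm y] are rounded; the remainder then has norm at most
    half of [cnorm y]. *)
Lemma gint_euclid x y : y != 0 -> exists q, cnorm (x - q * y) < cnorm y.
Proof.
rewrite -cnorm_gt0 => n0.
have [p hp] := nearest_multiple (cre (x * cconj y)) n0.
have [q hq] := nearest_multiple (cim (x * cconj y)) n0.
exists (Cplx p q); rewrite -(ltr_pM2l n0) -{1}(cnorm_conj y) -cnormM.
have -> : cconj y * (x - Cplx p q * y) = x * cconj y - Cplx p q * creal (cnorm y).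
  by rewrite -mulccconj; ring.
move: n0 hp hq; set n := cnorm y; case: (x * cconj y) => a b /= n0 hp hq.
rewrite [_ - _](_ : _ = Cplx (a - p * n) (b - q * n)).
  rewrite /cnorm /=.
have := ler_pM (normr_ge0 _) (normr_ge0 _) hp hp.
have := ler_pM (normr_ge0 _) (normr_ge0 _) hq hq.
rewrite -!normrM !ger0_norm -?expr2 ?sqr_ge0 // => hq2 hp2.
have : 0 < n * n by rewrite mulr_gt0.
nra.
by apply: cplxP => /=; ring.
Qed.

(** Euclid's algorithm by induction on the norm of [y]. The cofactors [x'] and [y'] are kept because
    later arguments divide by [g]. *)
Lemma gint_bezout x y : exists g x' y' s t,
  [/\ x = g * x', y = g * y' & g = s * x + t * y].
Proof.
have [k] := ubnP `|cnorm y|%N; elim: k => // k IH in x y *.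
rewrite ltnS => hk; have [->|y0] := eqVneq y 0.
  by exists x, 1, 0, 1, 0; rewrite mulr1 mulr0 mul1r addr0.
have [q hq] := gint_euclid x y0.
have [|g [y' [r' [s [t [ey er eg]]]]]] := IH y (x - q * y).
  by have := cnorm_ge0 (x - q * y); lia.
exists g, (r' + q * y'), y', t, (s - t * q); split => //.
  by rewrite mulrDr -er mulrCA -ey addrNK.
by rewrite eg; ring.
Qed.

(* Bezout cubed: [1 = (s u + t v)^3] lies in the ideal generated by [u^2] and [v^2]. *)
Lemma coprime_sqr_dvd u v s t z1 z2 : s * u + t * v = 1 ->
  u ^+ 2 * z1 = v ^+ 2 * z2 -> exists c, z1 = v ^+ 2 * c.
Proof.
move=> e1 e2.
exists ((s ^+ 3 * u + 3 * s ^+ 2 * t * v) * z2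
        + (3 * s * t ^+ 2 * u + t ^+ 3 * v) * z1).
have -> : v ^+ 2 * ((s ^+ 3 * u + 3 * s ^+ 2 * t * v) * z2
        + (3 * s * t ^+ 2 * u + t ^+ 3 * v) * z1) =
  (s ^+ 3 * u + 3 * s ^+ 2 * t * v) * (v ^+ 2 * z2)
        + v ^+ 2 * (3 * s * t ^+ 2 * u + t ^+ 3 * v) * z1 by ring.
have h : (s * u + t * v) ^+ 3 * z1 = z1 by rewrite e1 expr1n mul1r.
by rewrite -e2 -[LHS]h; ring.
Qed.

(** All square divisors are tested, not only squares of primes; [gaussian_squarefreeP] compares the
    two forms. Zero is excluded. *)
Definition gsquarefree z := forall d c, z = d ^+ 2 * c -> cnorm d = 1.

Lemma gsquarefree_neq0 z : gsquarefree z -> z != 0.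
Proof. by move=> h; apply/eqP => z0; have := h 0 0; rewrite mulr0 => /(_ z0). Qed.

Lemma gsquarefree_conj z : gsquarefree z -> gsquarefree (cconj z).
Proof.
move=> h d c e; rewrite -cnorm_conj; apply: (h _ (cconj c)).
by rewrite -(cconjK z) e !expr2 !cconjM.
Qed.

(** After division by the gcd, coprimality makes the square of each reduced factor divide one of
    [z1], [z2], so both reduced factors are units. *)
Lemma gsquarefree_ratio x y z1 z2 : x != 0 -> y != 0 ->
  gsquarefree z1 -> gsquarefree z2 -> x ^+ 2 * z1 = y ^+ 2 * z2 ->
  exists2 u, cnorm u = 1 & x = u * y.
Proof.
move=> x0 y0 s1 s2 e.
have [g [x' [y' [s [t [ex ey eg]]]]]] := gint_bezout x y.
have g0 : g != 0 by apply: contraNneq x0 => g0; rewrite ex g0 mul0r.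
have e1 : s * x' + t * y' = 1.
  by apply: (gmulI g0); rewrite [RHS]mulr1 {2}eg ex ey; ring.
have e2 : x' ^+ 2 * z1 = y' ^+ 2 * z2.
  apply: (gmulI (gmul_neq0 g0 g0)).
  have -> : g * g * (x' ^+ 2 * z1) = (g * x') ^+ 2 * z1 by ring.
  by rewrite -ex e ey; ring.
have [c1 /s1 uy] := coprime_sqr_dvd e1 e2.
rewrite addrC in e1.
have [c2 /s2 ux] := coprime_sqr_dvd e1 (esym e2).
(* The quotient of [x'] by the unit [y'], whose inverse is its conjugate. *)
exists (x' * cconj y'); first by rewrite cnormM cnorm_conj ux uy.
by rewrite ex ey mulrACA [cconj y' * y']mulrC mulccconj uy mulr1 mulrC.
Qed.

Lemma gint_unit u : cnorm u = 1 -> u \in [:: 1; -1; Cplx 0 1; Cplx 0 (-1)].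
Proof.
case: u => a b; rewrite /cnorm /= => e.
have ha : -1 <= a <= 1 by nia.
have hb : -1 <= b <= 1 by nia.
have : (a = 1 /\ b = 0) \/ (a = -1 /\ b = 0) \/ (a = 0 /\ b = 1) \/ (a = 0 /\ b = -1) by nia.
by case=> [[-> ->]|[[-> ->]|[[-> ->]|[-> ->]]]]; rewrite !inE.
Qed.

(** Descent on the norm reaches a nonunit divisor with no nonunit divisor of smaller norm; Bezout
    shows that it is prime. *)
Lemma gint_prime_factor x : x != 0 -> cnorm x != 1 ->
  exists p c, [/\ x = p * c, p != 0, cnorm p != 1 &
    forall a b q, a * b = p * q -> (exists a', a = p * a') \/ (exists b', b = p * b')].
Proof.
have [k] := ubnP `|cnorm x|%N; elim: k => // k IH in x *.
rewrite ltnS => hk x0 x1.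
have [[y [z [e y0 y1 yx]]]|hmin] := pselect (exists y z,
    [/\ x = y * z, y != 0, cnorm y != 1 & cnorm y < cnorm x]).
  have yk : (`|cnorm y| < k)%N by have := cnorm_ge0 y; lia.
  have [p [c [ey p0 p1 hp]]] := IH y yk y0 y1.
  by exists p, (c * z); split => //; rewrite mulrA -ey.
exists x, 1; split; rewrite ?mulr1 // => a b q e.
have [g [x' [a' [s [t [ex ea eg]]]]]] := gint_bezout x a.
have g0 : g != 0 by apply: contraNneq x0 => g0; rewrite ex g0 mul0r.
have [g1|g1] := eqVneq (cnorm g) 1.
  (* Bezout times [b]: [g * b = x * (s * b) + t * (a * b)], where [x] divides both terms and [g] is
     a unit. *)
  right; exists (cconj g * (s * b + t * q)).
  rewrite mulrCA mulrDr [x * (t * q)]mulrCA -e.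
  have -> : x * (s * b) + t * (a * b) = (s * x + t * a) * b by ring.
  by rewrite -eg mulrA [cconj g * g]mulrC mulccconj g1 mul1r.
left; exists (cconj x' * a').
(* Otherwise [g] would be a nonunit divisor of [x] of smaller norm. So [x] is an associate of [g],
   which divides [a]. *)
have x'1 : cnorm x' = 1.
  apply/eqP; apply: contra_notT hmin => x'1; exists g, x'; split => //.
  rewrite ex cnormM ltr_pMr ?cnorm_gt0 //.
  have : 0 < cnorm x'.
    by rewrite cnorm_gt0; apply: contraNneq x0 => h; rewrite ex h mulr0.
  by lia.
by rewrite mulrA ex -(mulrA g) mulccconj x'1 mulr1.
Qed.

End GaussianIntegers.

(** * Integral encoding of Hurwitz quaternions, and divisibility *)

Section Parity.
Implicit Types (A B C T E : quat int) (w : gint) (p M : int).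

(* A Hurwitz quaternion [alpha] is encoded by the integral quaternion [2 alpha]. *)
Definition same_parity A := exists a u v w : int, A = Quat a (a + 2 * u) (a + 2 * v) (a + 2 * w).

Lemma same_parity_mul A (x : gint) : same_parity A -> same_parity (A * qcplx x).
Proof.
case=> a [u [v [w ->]]]; case: x => x y; rewrite /qcplx QuatE /=.
exists (a * x - (a + 2 * u) * y), (a * y + u * x + u * y),
  (v * x + w * y + a * y + u * y), (w * x - v * y + u * y).
by congr Quat; ring.
Qed.

Lemma same_parity_odd_div (k : int) A : same_parity (qscal (2 * k + 1) * A) -> same_parity A.
Proof.
case: A => a b c d [x [u [v [w]]]]; rewrite /qscal QuatE /= => -[e0 e1 e2 e3].
(* From [(2k + 1)(b - a) = 2u] follows [b - a = 2(u - k(b - a))]; likewise for [c] and [d]. *)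
exists a, (u - k * (b - a)), (v - k * (c - a)), (w - k * (d - a)).
by congr Quat; lia.
Qed.

Lemma int_parity (x : int) : exists y, x = 2 * y \/ x = 2 * y + 1.
Proof. exists (x %/ 2)%Z; lia. Qed.

Lemma qscalI (p : int) A B : p != 0 -> qscal p * A = qscal p * B -> A = B.
Proof.
move=> p0; case: A B => [? ? ? ?] [? ? ? ?]; rewrite /qscal !QuatE /= => -[].
rewrite !mul0r !(addr0, subr0) => /(mulfI p0)-> /(mulfI p0)-> /(mulfI p0)->.
by move/(mulfI p0)->.
Qed.

Lemma qnorm_scal (c : int) : qnorm (qscal c) = c ^+ 2.
Proof. by rewrite /qnorm /=; ring. Qed.

Lemma qnorm_same_parity A : same_parity A -> exists e, qnorm A = 4 * e.
Proof.
move=> [a [u [v [w ->]]]]; rewrite /qnorm /=.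
exists (a ^+ 2 + a * (u + v + w) + u ^+ 2 + v ^+ 2 + w ^+ 2); ring.
Qed.

(** A Hurwitz quaternion of even norm is right divisible by [1 + i]: the norm condition makes [a]
    and [u + v + w] even, which is what the quotient needs to have coordinates of equal parity. *)
Lemma same_parity_div_1i A e : same_parity A -> qnorm A = 8 * e ->
  exists2 B, same_parity B & A = B * qcplx (Cplx 1 1).
Proof.
move=> [a [u [v [w ->]]]]; rewrite /qnorm /= => hn.
have sqr_parity (x : int) : exists y, x ^+ 2 = x + 2 * y.
  by have [y [->|->]] := int_parity x;
     [exists (2 * y ^+ 2 - y) | exists (2 * y ^+ 2 + y)]; ring.
have [u' hu] := sqr_parity u; have [v' hv] := sqr_parity v.
have [w' hw] := sqr_parity w.
(* Squares are congruent to their roots mod 2, so only [a] and the sum [u + v + w] matter. *)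
have {hn} h2 : a ^+ 2 + a * (u + v + w) + (u + v + w) + 2 * (u' + v' + w') = 2 * e.
  apply: (@mulfI _ 4) => //; rewrite mulrA -hn.
  transitivity (4 * (a ^+ 2 + a * (u + v + w) + u ^+ 2 + v ^+ 2 + w ^+ 2)); last by ring.
  by rewrite hu hv hw; ring.
have [a' ha] : exists a', a = 2 * a'.
  have [a' [->|ha]] := int_parity a; first by exists a'.
  exfalso; set s := u + v + w in h2.
  suff : 2 * (2 * (a' ^+ 2 + a') + a' * s + s + (u' + v' + w') - e) = -1 by lia.
  rewrite mulrBr -h2 ha; ring.
have [s hs] : exists s, u + v + w = 2 * s.
  set s := u + v + w in h2 *.
  exists (e - (2 * a' ^+ 2 + a' * s + (u' + v' + w'))).
  by rewrite mulrBr -h2 ha; ring.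
(* This is [A * (1 - i) / 2]. *)
exists (Quat (a + u) u (v - w) (a + v + w)).
  exists (a + u), (- a'), (v - s - a'), (s - u).
  have -> : w = 2 * s - u - v by rewrite -hs; ring.
  by rewrite ha; congr Quat; ring.
by rewrite /qcplx QuatE /=; congr Quat; ring.
Qed.

Definition qdvd p A := exists B, A = qscal p * B.

Lemma qdvdD p A B : qdvd p A -> qdvd p B -> qdvd p (A + B).
Proof. by move=> [A' ->] [B' ->]; exists (A' + B'); rewrite mulrDr. Qed.
Lemma qdvd_mull p c A : qdvd p A -> qdvd p (qscal c * A).
Proof. by move=> [A' ->]; exists (qscal c * A'); rewrite !mulrA -!qscalM mulrC. Qed.

Lemma Euclid_dvdzM (p : nat) (x y : int) : prime p ->
  (p %| x * y)%Z = (p %| x)%Z || (p %| y)%Z.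
Proof. by move=> pp; rewrite !dvdzE abszM Euclid_dvdM. Qed.

(** Sums and differences of the coordinates of the two twins are [4ab], [4cd], [2(a^2 - b^2)] and
    [2(c^2 - d^2)]. As [p] is odd, it divides one of [a], [b] by the product, and then both by the
    difference of squares; the same holds for [c], [d]. *)
Lemma odd_prime_dvd_twins (p : nat) A : prime p -> odd p ->
  qdvd p (twin_j A 1) -> qdvd p (twin_k A 1) -> qdvd p A.
Proof.
move=> pp op; case: A => a b c d; rewrite twin_j1E twin_k1E /=.
move=> [[x0 x1 x2 x3]]; rewrite /qscal QuatE /= !mul0r !(subr0, addr0) => -[_ _ e2 e3].
move=> [[y0 y1 y2 y3]]; rewrite QuatE /= !mul0r !(subr0, addr0) => -[_ _ f2 f3].
have p2 : (p %| 2%:Z)%Z = false.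
  by apply/negP => h; have := dvdn_leq (isT : (0 < 2)%N) h; have := prime_gt1 pp; lia.
have half (x : int) : (p %| 2 * x)%Z -> (p %| x)%Z by rewrite Euclid_dvdzM // p2.
have pm (x z : int) : x = p%:Z * z -> (p %| x)%Z by move=> ->; rewrite dvdz_mulr.
have hab : (p %| a * b)%Z by apply/half/half/(@pm _ (x3 - y2)); rewrite [RHS]mulrBr -e3 -f2; ring.
have hcd : (p %| c * d)%Z by apply/half/half/(@pm _ (x3 + y2)); rewrite [RHS]mulrDr -e3 -f2; ring.
have hab2 : (p %| a ^+ 2 - b ^+ 2)%Z by apply: half; apply: (@pm _ (x2 + y3)); rewrite [RHS]mulrDr -e2 -f3; ring.
have hcd2 : (p %| c ^+ 2 - d ^+ 2)%Z by apply: half; apply: (@pm _ (x2 - y3)); rewrite [RHS]mulrBr -e2 -f3; ring.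
have key (x y : int) : (p %| x * y)%Z -> (p %| x ^+ 2 - y ^+ 2)%Z ->
    exists x' y', x = p%:Z * x' /\ y = p%:Z * y'.
  move=> h h2; have hx : (p %| x)%Z = (p %| y)%Z.
    have : (p %| x ^+ 2)%Z = (p %| y ^+ 2)%Z.
      by apply/idP/idP => h3; [rewrite -(subKr (x ^+ 2) (y ^+ 2)) rpredB
        | rewrite -(subrK (y ^+ 2) (x ^+ 2)) rpredD].
    by rewrite !expr2 !Euclid_dvdzM // !orbb.
  move: h; rewrite Euclid_dvdzM // hx orbb => hy; move: (hy); rewrite -hx.
  by case/dvdzP=> x' ->; case/dvdzP: hy => y' ->; exists x', y'; rewrite !(mulrC p%:Z).
have [a' [b' [-> ->]]] := key _ _ hab hab2.
have [c' [d' [-> ->]]] := key _ _ hcd hcd2.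
by exists (Quat a' b' c' d'); rewrite QuatE; congr Quat; ring.
Qed.

End Parity.

(** * Removal of denominators, prime by prime *)

Section Descent.
Implicit Types (A B C T E : quat int) (w : gint) (M : int).

Lemma two_dvd_gint w k : cnorm w = 4 * k -> exists w', w = creal 2 * w'.
Proof.
case: w => x y; rewrite /cnorm /=.
have [a [->|->]] := int_parity x; have [b [->|->]] := int_parity y => h.
- by exists (Cplx a b); rewrite /creal CplxE; congr Cplx; ring.
- exfalso; have : 4 * (a ^+ 2 + b ^+ 2 + b - k) = -1 by rewrite mulrBr -h; ring.
  by move: (_ - k) => ?; lia.
- exfalso; have : 4 * (a ^+ 2 + b ^+ 2 + a - k) = -1 by rewrite mulrBr -h; ring.
  by move: (_ - k) => ?; lia.
- exfalso; have : 4 * (a ^+ 2 + b ^+ 2 + a + b - k) = -2 by rewrite mulrBr -h; ring.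
  by move: (_ - k) => ?; lia.
Qed.

Lemma same_parity_real_div (p : nat) A : odd p -> same_parity (qscal p%:Z * A) -> same_parity A.
Proof.
move=> op; have -> : p = 2 * (p./2)%:Z + 1 :> int by lia.
exact: same_parity_odd_div.
Qed.

(* Then [twin_j A w = p * twin_j C v], and likewise for [twin_k]. *)
Definition refactor (p : nat) A w := exists C h v,
  [/\ A = C * qcplx h, same_parity C & h * h * w = creal p%:Z * v].

Lemma refactor_dvd (p : nat) A w w' : same_parity A -> w = creal p%:Z * w' -> refactor p A w.
Proof.
move=> hA ->; exists A, 1, w'; split=> //; last by rewrite !mul1r.
by rewrite [qcplx 1](_ : _ = 1) ?mulr1.
Qed.

Lemma refactor2 A w T M : same_parity A -> twin_j A w = qscal (8 * M) * T -> refactor 2 A w.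
Proof.
move=> hA e; have [k hk] := qnorm_same_parity hA.
have : qnorm (twin_j A w) = qnorm (qscal (8 * M) * T) by rewrite e.
rewrite qnorm_twj qnormM qnorm_scal hk => {}e.
have {}e : k ^+ 2 * cnorm w = 4 * (M ^+ 2 * qnorm T).
  by apply: (@mulfI _ 16) => //; transitivity ((4 * k) ^+ 2 * cnorm w); [ring | rewrite e; ring].
(* Here [k] is the norm of the encoded quaternion. If [k] is even, [1 + i] splits off [A], and
   [(1 + i)^2 = 2i] supplies the factor 2; if [k] is odd, 4 divides the norm of [w]. *)
have [l [kl|kl]] := int_parity k.
  have [|B hB eA] := @same_parity_div_1i A l hA; first by rewrite hk kl; ring.
  by exists B, (Cplx 1 1), (Cplx 0 1 * w); split => //; rewrite mulrA; congr (_ * _).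
have [w' hw] : exists w', w = creal 2 * w'.
  apply: (@two_dvd_gint w (M ^+ 2 * qnorm T - (l ^+ 2 + l) * cnorm w)).
  by rewrite mulrBr -e kl; ring.
exact: refactor_dvd hw.
Qed.

Lemma refactor_odd (p : nat) A w : prime p -> odd p -> same_parity A ->
  qdvd p (twin_j A w) -> qdvd p (twin_k A w) -> refactor p A w.
Proof.
move=> pp op hA dj dk.
have [g [w' [p' [s [t [ew ep eg]]]]]] := gint_bezout w (creal p%:Z).
(* The multiples of [g] lie in the ideal generated by [w] and [p], where [twin_j A] is divisible by
   [p]. *)
have dg x : qdvd p (twin_j A (g * x)).
  have -> : g * x = s * x * w + creal p%:Z * (t * x) by rewrite {1}eg; ring.
  rewrite twin_jD; apply: qdvdD; last by rewrite twin_j_scal; eexists.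
  by rewrite twin_j_mulE; apply: qdvdD; apply: qdvd_mull.
have [C eC] : qdvd p (A * qcplx g).
  apply: odd_prime_dvd_twins => //; first by rewrite twin_j_mul mulr1.
  by rewrite twin_k_mul mulr1 -twin_j_i mulrCA.
have hC : same_parity C by apply: (@same_parity_real_div p) => //; rewrite -eC; apply: same_parity_mul.
have eAC : A * qscal (cnorm g) = qscal p%:Z * (C * qcplx (cconj g)).
  by rewrite -qcplx_real -mulccconj qcplxM !mulrA eC.
have pz : (p : int) != 0 by have := prime_gt0 pp; lia.
have en : cnorm g * cnorm p' = p%:Z ^+ 2 by rewrite -cnormM -ep /cnorm /=; ring.
(* The norm of [g] is 1, [p] or [p^2]. In the first two cases [eAC] splits a Gaussian factor off
   [A]; in the last, [g] is an associate of [p], so [p] divides [w]. *)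
have /(dvdn_pfactor _ _ pp)[e e2 ee] : (`|cnorm g| %| p ^ 2)%N.
  by apply/dvdnP; exists `|cnorm p'|%N; rewrite -abszM mulrC en abszX.
have {}ee : cnorm g = (p ^ e)%N by have := cnorm_ge0 g; lia.
case: e e2 ee => [|[|[|//]]] _ ee.
- exists C, (creal p%:Z * cconj g), (creal p%:Z * cconj g * cconj g * w); split=> //; last by ring.
  have -> : A = A * qscal (cnorm g) by rewrite ee [qscal _](_ : _ = 1) ?mulr1.
  by rewrite eAC qcplxM qcplx_real !mulrA qscalC.
- exists C, (cconj g), (cconj g * w'); split=> //.
    by apply: (qscalI pz); rewrite -eAC ee expn1 qscalC.
  have -> : cconj g * cconj g * w = (g * cconj g) * (cconj g * w') by rewrite ew; ring.
  by rewrite mulccconj ee expn1.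
- apply: (@refactor_dvd _ _ _ (cconj p' * w')) => //.
  have p1 : cnorm p' = 1.
    have ep2 : cnorm g = p%:Z ^+ 2 by rewrite ee; lia.
    by apply: (@mulfI _ (p%:Z ^+ 2)); rewrite ?expf_neq0 // mulr1 -[RHS]en ep2.
  by rewrite ep -mulrA [p' * _]mulrA mulccconj p1 mul1r.
Qed.

(** Strong induction on [m], one least prime factor at a time. The factor 4 accounts for the two
    denominators in [alpha = A / 2], so the case [m = 1] is already a Hurwitz parameterization. *)
Lemma reparameterize (m : nat) A w T E : (0 < m)%N -> same_parity A ->
  twin_j A w = qscal (4 * m%:Z) * T -> twin_k A w = qscal (4 * m%:Z) * E ->
  exists A' w', [/\ same_parity A', twin_j A' w' = qscal 4 * T & twin_k A' w' = qscal 4 * E].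
Proof.
have [k] := ubnP m; elim: k => // k IH in m A w *; rewrite ltnS => mk m0 hA ej ek.
have [m1|m1] := leqP m 1.
  by exists A, w; split; rewrite ?ej ?ek // (_ : m = 1%N) //; lia.
have pp := pdiv_prime m1; set p := pdiv m in pp.
have [m' em] := dvdnP (pdiv_dvd m); rewrite -/p in em.
have p1 := prime_gt1 pp.
have em' : 4 * m%:Z = p%:Z * (4 * m'%:Z) by rewrite em PoszM; ring.
have [C [h [v [eA hC ev]]]] : refactor p A w.
  have [p2|p2] := boolP (odd p).
    by apply: refactor_odd => //; [rewrite ej | rewrite ek]; rewrite em' qscalM -mulrA; eexists.
  have p2' : p = 2%N by case: (even_prime pp) p2 => // ->.
  rewrite p2'; apply: (@refactor2 _ _ T m') => //; rewrite ej em' p2'; congr (qscal _ * _); ring.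
have pz : (p : int) != 0 by lia.
apply: (IH m' C v) => //; first by nia.
- by lia.
- by apply: (qscalI pz); rewrite -twin_j_scal -ev -twin_j_mul -eA ej em' qscalM mulrA.
- by apply: (qscalI pz); rewrite -twin_k_scal -ev -twin_k_mul -eA ek em' qscalM mulrA.
Qed.

End Descent.

(** * Rotating given twins to multiples of [j] and [k] *)

Section TwinRotation.
Implicit Types (A B C T E X : quat int) (w : gint) (M : int).

Lemma qnorm_eq0 A : (qnorm A == 0) = (A == 0).
Proof.
apply/eqP/eqP => [|->]; last by rewrite /qnorm /= expr0n.
case: A => a b c d; rewrite /qnorm /= => /eqP.
rewrite !paddr_eq0 ?addr_ge0 ?sqr_ge0 // !sqrf_eq0.
by case/andP=> /andP[/andP[/eqP-> /eqP->] /eqP->] /eqP->.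
Qed.

Lemma qnorm_ge0 A : 0 <= qnorm A.
Proof. by rewrite /qnorm !addr_ge0 ?sqr_ge0. Qed.

Lemma anticommute_i_j_part X : X * qi = - (qi * X) ->
  X = qcplx (Cplx (q2 X) (q3 X)) * qj.
Proof.
case: X => a b c d; rewrite /qi /qcplx /qj !QuatE QuatN /= => -[h1 h2 _ _].
by congr Quat; lia.
Qed.

Lemma mulqq_pure T : q0 T = 0 -> T * T = - qscal (qnorm T).
Proof.
case: T => a b c d /= ->.
by rewrite /qnorm /qscal QuatE QuatN /=; congr Quat; ring.
Qed.

Lemma qconj_pure T : q0 T = 0 -> qconj T = - T.
Proof. by case: T => a b c d /= ->; rewrite /qconj QuatN /= oppr0. Qed.

Lemma mulqC_orthogonal T E : q0 T = 0 -> q0 E = 0 ->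
  q1 T * q1 E + q2 T * q2 E + q3 T * q3 E = 0 -> E * T = - (T * E).
Proof.
case: T E => [a b c d] [a' b' c' d'] /= -> -> e.
rewrite !QuatE QuatN; congr Quat; try by ring.
by apply: subr0_eq; transitivity (- 2 * (b * b' + c * c' + d * d')); [ring | rewrite e mulr0].
Qed.

(* The real span of [T], [E] is rotated onto that of [j], [k] by any nonzero
   solution [B] of [T E B = n B i], and [B = T E q + n q i] is a solution for every [q]. *)
Lemma twin_rotation T E : q0 T = 0 -> q0 E = 0 -> qnorm T != 0 ->
  qnorm T = qnorm E -> q1 T * q1 E + q2 T * q2 E + q3 T * q3 E = 0 ->
  exists B w, [/\ B != 0, qconj B * T * B = qcplx w * qj
    & qconj B * E * B = qcplx w * qk].
Proof.
move=> pT pE n0 nTE /(mulqC_orthogonal pT pE) ET.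
have TT := mulqq_pure pT; have EE := mulqq_pure pE; rewrite -nTE in EE.
set n := qnorm T in n0 TT EE *.
have cn A D : A * (qscal n * D) = qscal n * (A * D) by rewrite mulrA -qscalC mulrA.
have ii : qi * qi = -1 :> quat int by [].
have [z ez] : exists z, z = T * E by eexists.
have TET : T * E * T = qscal n * E by rewrite -mulrA ET mulrN mulrA TT mulNr opprK.
have zz : z * z = - (qscal n * qscal n).
  by rewrite ez mulrA TET -mulrA EE mulrN.
have [B B0 zB] : exists2 B, B != 0 & z * B = qscal n * (B * qi).
  have zq q : z * (z * q + qscal n * (q * qi)) =
              qscal n * ((z * q + qscal n * (q * qi)) * qi).
    rewrite mulrDr mulrDl [in RHS]mulrDr [z * (z * q)]mulrA zz cn addrC -!mulrA ii.
    by rewrite !mulrN mulr1 mulNr -mulrA.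
  (* Take [q = 1] unless that gives zero. In that case [T E = - n i], and [q = j] gives [- 2 n k],
     which is nonzero. *)
  have [h|h] := eqVneq (z + qscal n * qi) 0; last first.
    exists (z * 1 + qscal n * (1 * qi)); last exact: zq.
    by rewrite mulr1 mul1r.
  exists (z * qj + qscal n * (qj * qi)); last exact: zq.
  move: h => /eqP; rewrite addr_eq0 => /eqP->.
  apply/eqP; rewrite /qscal /qi /qj !QuatE QuatN ?QuatE /= => -[_ _ _ h].
  by move: n0; rewrite -/n; lia.
have zBc : qconj B * z = qscal n * (qi * qconj B).
  have := congr1 (@qconj int) zB; rewrite !qconjM ez qconjM.
  rewrite (qconj_pure pT) (qconj_pure pE) mulrNN ET mulrN => /eqP.
  rewrite -eqr_opp opprK => /eqP->.
  have -> : qconj (qscal n) = qscal n by rewrite /qconj /= !oppr0.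
  have -> : qconj qi = - qi :> quat int by rewrite /qconj /qi QuatN /= !oppr0.
  by rewrite mulNr mulNr opprK -qscalC.
exists B.
set X := qconj B * T * B; set Y := qconj B * E * B.
(* Up to the factor [n], [X * qi] is [qconj B * T * (T * E) * B], and [T * T = - n]. *)
have Xi : X * qi = - Y.
  apply: (qscalI n0); rewrite /X -(mulrA _ B) -cn -zB ez !mulrA -(mulrA _ T T) TT.
  by rewrite /Y mulrN !mulNr mulrN -qscalC -!mulrA.
have iX : qi * X = Y.
  (* The conjugate relation [zBc] puts [T * E] on the left of [T], and [T * E * T = n E]. *)
  apply: (qscalI n0); rewrite /X !mulrA -(mulrA (qscal n)) -zBc ez.
  by rewrite -(mulrA _ _ T) TET /Y !mulrA -qscalC -!mulrA.
have eX : X = qcplx (Cplx (q2 X) (q3 X)) * qj.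
  by apply: anticommute_i_j_part; rewrite Xi iX.
exists (Cplx (q2 X) (q3 X)); split => //.
rewrite -iX {1}eX; case: X {Xi iX eX} => ? ? ? ?.
by rewrite /qcplx /qi /qj /qk !QuatE /=; congr Quat; ring.
Qed.

Lemma twins_parameterization T E : q0 T = 0 -> q0 E = 0 -> qnorm T != 0 ->
  qnorm T = qnorm E -> q1 T * q1 E + q2 T * q2 E + q3 T * q3 E = 0 ->
  exists A w, [/\ same_parity A, twin_j A w = qscal 4 * T & twin_k A w = qscal 4 * E].
Proof.
move=> pT pE n0 nTE dTE.
have [B [w [B0 hT hE]]] := twin_rotation pT pE n0 nTE dTE.
have N0 : 0 < qnorm B by rewrite lt0r qnorm_eq0 B0 qnorm_ge0.
have eN (X : quat int) : qscal 2 * B * (qconj B * X * B) * qconj (qscal 2 * B)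
    = qscal (4 * (qnorm B ^+ 2)) * X.
  rewrite qconjM [qconj (qscal 2)](_ : _ = qscal 2) //.
  transitivity (qscal 2 * (B * qconj B) * X * (B * qconj B) * qscal 2).
    by rewrite !mulrA.
  rewrite mulqconj -(mulrA _ X) -(qscalC _ X) -(qscalC 2) !mulrA -!qscalM.
  by congr (qscal _ * _); ring.
(* The integral [B] is encoded by [2 B], and by [eN] the denominator to be removed is
   [qnorm B ^ 2]. *)
have [||||A' [w' h]] := @reparameterize (`|qnorm B| ^ 2)%N (qscal 2 * B) w T E.
- by rewrite expn_gt0; lia.
- case: B {B0 hT hE N0 eN} => a b c d; rewrite /qscal QuatE /=.
  by exists (2 * a), (b - a), (c - a), (d - a); congr Quat; ring.
- by rewrite /twin_j -(mulrA _ (qcplx w)) -hT eN; congr (qscal _ * _); lia.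
- by rewrite /twin_k -(mulrA _ (qcplx w)) -hE eN; congr (qscal _ * _); lia.
by exists A', w'.
Qed.

End TwinRotation.

(** * Integrality, squarefree parameters and uniqueness *)

Section Uniqueness.
Implicit Types (A B C T E X : quat int) (w z : gint) (M : int).

(** Half-integral quaternions still parameterize integral vectors. By linearity in [z] only [z = 1]
    is to be expanded, for both twins. *)
Lemma same_parity_twj_int A z : same_parity A ->
  exists2 T, q0 T = 0 & twin_j A z = qscal 4 * T.
Proof.
move=> [a [u [v [w ->]]]]; rewrite twin_jE.
suff [[T T0 ->] [E E0 ->]] : (exists2 T, q0 T = 0 &
    twin_j (Quat a (a + 2 * u) (a + 2 * v) (a + 2 * w)) 1 = qscal 4 * T)
  /\ (exists2 E, q0 E = 0 &
    twin_k (Quat a (a + 2 * u) (a + 2 * v) (a + 2 * w)) 1 = qscal 4 * E).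
  exists (qscal (cre z) * T + qscal (cim z) * E).
    by move: T0 E0; case: T E => ? ? ? ? [? ? ? ?] /= -> ->; ring.
  by rewrite mulrDr !mulrA -!qscalM !(mulrC 4).
split.
  exists (Quat 0 (a * v + a * u + 2 * u * v - a * w)
    (- a * u - u ^+ 2 + a * v + v ^+ 2 - a * w - w ^+ 2)
    (a ^+ 2 + a * u + a * v + a * w + 2 * v * w)) => //.
  by rewrite twin_j1E /qscal QuatE /=; congr Quat; ring.
exists (Quat 0 (a ^+ 2 + a * u + a * v + a * w + 2 * u * w)
    (a * v + a * w + 2 * v * w - a * u)
    (- a * u - u ^+ 2 - a * v - v ^+ 2 + a * w + w ^+ 2)) => //.
by rewrite twin_k1E /qscal QuatE /=; congr Quat; ring.
Qed.

Lemma gsquarefree1 : gsquarefree 1.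
Proof.
move=> d c /(congr1 (@cnorm _)); rewrite cnorm1 expr2 !cnormM => e.
have : (cnorm d %| 1)%Z by apply/dvdzP; exists (cnorm d * cnorm c); rewrite mulrC mulrA -e.
by have := cnorm_ge0 d; rewrite dvdz1; lia.
Qed.

Lemma squarefree_reparameterization A z : same_parity A ->
  exists A' z', [/\ same_parity A', gsquarefree z', twin_j A z = twin_j A' z' & twin_k A z = twin_k A' z'].
Proof.
have [k] := ubnP `|cnorm z|%N; elim: k => // k IH in A z *; rewrite ltnS => hk hA.
have [->|z0] := eqVneq z 0.
  (* Both twins vanish for [z = 0]; since 0 is not squarefree, the zero moves to the first
     component. *)
  exists 0, 1; split; [by exists 0, 0, 0, 0 | exact: gsquarefree1 | |].
    by rewrite /twin_j [qcplx 0](_ : _ = 0) // mulr0 !mul0r.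
  by rewrite /twin_k [qcplx 0](_ : _ = 0) // mulr0 !mul0r.
have [zs|/existsNP[d /existsNP[c /not_implyP[e d1]]]] := pselect (gsquarefree z).
  by exists A, z.
have zc : (`|cnorm c| < k)%N.
  have d0 : 0 < cnorm d.
    by rewrite cnorm_gt0; apply: contraNneq z0 => d0; rewrite e d0 expr0n mul0r.
  have c0 : 0 < cnorm c.
    by rewrite cnorm_gt0; apply: contraNneq z0 => c0; rewrite e c0 mulr0.
  have dd : 1 < cnorm d * cnorm d by nia.
  have : cnorm c < cnorm z by rewrite e expr2 !cnormM ltr_pMl.
  by lia.
have [A' [z' [hA' zs' ej ek]]] := IH (A * qcplx d) c zc (same_parity_mul d hA).
by exists A', z'; rewrite e expr2 -twin_j_mul -twin_k_mul.
Qed.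

Lemma twin_j_conj (A B : quat int) z : twin_j (B * A) z = B * twin_j A z * qconj B.
Proof. by rewrite /twin_j qconjM !mulrA. Qed.
Lemma twin_k_conj (A B : quat int) z : twin_k (B * A) z = B * twin_k A z * qconj B.
Proof. by rewrite /twin_k qconjM !mulrA. Qed.

Lemma mul_zj_zk z : qcplx z * qj * (qcplx z * qk) = qscal (cnorm z) * qi.
Proof.
rewrite mulrA -(mulrA _ qj) -[z in qj * qcplx z]cconjK -qcplx_j mulrA -qcplxM.
by rewrite mulccconj qcplx_real -mulrA.
Qed.

(** As [z j z k = N(z) i], the product of the twins depends on [z] only through its norm and
    exhibits the image of [i] under [A]. This serves both uniqueness and orthogonality. *)
Lemma twin_j_mul_twin_k A z :
  twin_j A z * twin_k A z = qscal (qnorm A * cnorm z) * (A * qi * qconj A).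
Proof.
rewrite /twin_j /twin_k.
transitivity (A * (qcplx z * qj) * (qconj A * A) * (qcplx z * qk) * qconj A).
  by rewrite !mulrA.
rewrite mulqconjl -(qscalC _ (A * _)).
transitivity (qscal (qnorm A) * (A * (qcplx z * qj * (qcplx z * qk)) * qconj A)).
  by rewrite !mulrA.
by rewrite mul_zj_zk qscalM -!mulrA; congr (_ * _); rewrite !mulrA qscalC.
Qed.

(** A rotation that fixes the direction of [i] has [i] as its axis. The positive signs exclude
    half-turns that send [i] to [-i], for which [A] lies in the span of [j] and [k]. *)
Lemma conj_i_eq_i A (c1 c2 : int) : 0 < c1 -> 0 < c2 ->
  qscal c1 * (A * qi * qconj A) = qscal c2 * qi -> exists g, A = qcplx g.
Proof.
case: A => a b c d c1p c2p.
have -> : Quat a b c d * qi * qconj (Quat a b c d) =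
    Quat 0 (a ^+ 2 + b ^+ 2 - c ^+ 2 - d ^+ 2) (2 * (a * d + b * c)) (2 * (b * d - a * c)).
  by rewrite /qi /qconj /= !QuatE; congr Quat => /=; ring.
rewrite /qscal /qi !QuatE /= => -[_].
rewrite !mul0r !mulr0 !(addr0, subr0) mulr1 => e1 e2 e3.
have {}e2 : a * d + b * c = 0 by move/eqP: e2; rewrite !mulf_eq0 gt_eqF //= => /eqP.
have {}e3 : b * d - a * c = 0 by move/eqP: e3; rewrite !mulf_eq0 gt_eqF //= => /eqP.
have pos : 0 < a ^+ 2 + b ^+ 2 - c ^+ 2 - d ^+ 2 by rewrite -(pmulr_rgt0 _ c1p) e1.
have : (a ^+ 2 + b ^+ 2) * (c ^+ 2 + d ^+ 2) = 0.
  transitivity ((a * d + b * c) ^+ 2 + (b * d - a * c) ^+ 2); first by ring.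
  by rewrite e2 e3; ring.
move/eqP; rewrite mulf_eq0 => /orP[/eqP h|].
  by have := sqr_ge0 c; have := sqr_ge0 d; move: pos h; lia.
rewrite paddr_eq0 ?sqr_ge0 // !sqrf_eq0 => /andP[/eqP-> /eqP->].
by exists (Cplx a b).
Qed.

Lemma parameterization_unique A1 A2 z1 z2 : A2 != 0 ->
  gsquarefree z1 -> gsquarefree z2 ->
  twin_j A1 z1 = twin_j A2 z2 -> twin_k A1 z1 = twin_k A2 z2 ->
  exists u, [/\ cnorm u = 1, A1 = A2 * qcplx u & z2 = u * u * z1].
Proof.
move=> A20 s1 s2 ej ek.
have N20 : 0 < qnorm A2 by rewrite lt0r qnorm_eq0 A20 qnorm_ge0.
have Z1 : 0 < cnorm z1 by rewrite cnorm_gt0 gsquarefree_neq0.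
have Z2 : 0 < cnorm z2 by rewrite cnorm_gt0 gsquarefree_neq0.
have N10 : 0 < qnorm A1.
  rewrite lt0r qnorm_ge0 andbT; apply: contraTneq Z2 => h.
  have := congr1 (@qnorm int) ej; rewrite !qnorm_twj h expr0n /= mul0r => /esym/eqP.
  by rewrite mulf_eq0 expf_eq0 /= (gt_eqF N20) /= => /eqP->; rewrite ltxx.
set N := qnorm A2 in N20.
(* Conjugation by [qconj A2] carries the second parameterization to multiples of [z2 j] and
   [z2 k]. *)
have hj X : qconj A2 * (A2 * X * qconj A2) * qconj (qconj A2) = qscal (N ^+ 2) * X.
  rewrite qconjK; transitivity (qconj A2 * A2 * X * (qconj A2 * A2)).
    by rewrite !mulrA.
  by rewrite mulqconjl -/N -qscalC mulrA -qscalM.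
have WJ : twin_j (qconj A2 * A1) z1 = qscal (N ^+ 2) * (qcplx z2 * qj).
  by rewrite twin_j_conj ej /twin_j -(mulrA A2) hj.
have WK : twin_k (qconj A2 * A1) z1 = qscal (N ^+ 2) * (qcplx z2 * qk).
  by rewrite twin_k_conj ek /twin_k -(mulrA A2) hj.
have [g eg] : exists g, qconj A2 * A1 = qcplx g.
  have := twin_j_mul_twin_k (qconj A2 * A1) z1; rewrite WJ WK => /esym e.
  apply: (conj_i_eq_i (c1 := qnorm (qconj A2 * A1) * cnorm z1) (c2 := N ^+ 2 * N ^+ 2 * cnorm z2)); last first.
  - rewrite e -mulrA [qcplx z2 * qj * _]mulrA -(qscalC _ (qcplx z2 * qj)).
    by rewrite -mulrA mul_zj_zk [LHS]mulrA [in LHS]mulrA -!qscalM.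
  - by rewrite !mulr_gt0 // exprn_gt0.
  - by rewrite mulr_gt0 // qnormM qnorm_conj mulr_gt0.
have g0 : g != 0.
  by rewrite -cnorm_eq0 -qnorm_cplx -eg qnormM qnorm_conj gt_eqF // mulr_gt0.
have eN : g ^+ 2 * z1 = creal N ^+ 2 * z2.
  apply: qcplx_inj; move: WJ; rewrite eg -[qcplx g]mul1r twin_j_mul /twin_j mul1r.
  rewrite [qconj 1](_ : _ = 1) // mulr1 mulrA => e.
  have jj : qj * - qj = 1 :> quat int by [].
  rewrite -!expr2 in e.
  (* Right multiplication by [- j] cancels the [j] on both sides. *)
  have := congr1 (fun q => q * - qj) e; rewrite -!mulrA jj !mulr1 => ->.
  by rewrite !qcplxM !qcplx_real expr2 qscalM -mulrA.
have rN0 : creal N != 0 by rewrite -cnorm_gt0 /cnorm /= expr0n addr0 exprn_gt0.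
have [u u1 eu] := gsquarefree_ratio g0 rN0 s1 s2 eN.
exists u; split => //.
  apply: (qscalI (lt0r_neq0 N20)).
  have -> : qscal N * A1 = A2 * (qconj A2 * A1) by rewrite mulrA mulqconj.
  by rewrite eg eu qcplxM qcplx_real mulrA -qscalC.
apply: (gmulI (gmul_neq0 rN0 rN0)); rewrite -expr2 -eN eu; ring.
Qed.

Lemma squarefree_square_norm z (a l : int) : gsquarefree z -> a != 0 ->
  a ^+ 2 * cnorm z = l ^+ 2 -> cre z = 0 \/ cim z = 0.
Proof.
move=> zs a0 e; have z0 := gsquarefree_neq0 zs.
have l0 : l != 0.
  apply: contraNneq z0 => l0; move/eqP: e.
  by rewrite l0 mulf_eq0 expf_eq0 /= (negPf a0) cnorm_eq0.
have ra : creal a != 0 by apply: contraNneq a0 => -[->].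
have rl : creal l != 0 by apply: contraNneq l0 => -[->].
(* The relation used is [(a z)^2 conj z = a^2 N(z) z = l^2 z]. *)
have [u /gint_unit] : exists2 u, cnorm u = 1 & creal a * z = u * creal l.
  apply: (gsquarefree_ratio (gmul_neq0 ra z0) rl (gsquarefree_conj zs) zs).
  transitivity (creal a ^+ 2 * (z * cconj z) * z); first by ring.
  by rewrite mulccconj !expr2 -!crealM -expr2 e.
case: z {zs e z0} => x y.
rewrite !inE => /or4P[]/eqP-> [] /= e1 e2; [right|right|left|left];
 by apply: (mulfI a0); lia.
Qed.

End Uniqueness.

(** Thus [u^2] is its own inverse, and [z2 = u^2 z1] is equivalent to [z1 = u^2 z2]. *)
Lemma gint_unit4 (u : gint) : cnorm u = 1 -> u * u * (u * u) = 1.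
Proof. by move/gint_unit; rewrite !inE => /or4P[]/eqP->. Qed.

(** * Transfer from integral encodings to real quaternions *)

Section Lift.
Variable R : realType.
Implicit Types (A B T E : quat int) (g u : gint).

Definition qlift A : quat R := Quat (q0 A)%:~R (q1 A)%:~R (q2 A)%:~R (q3 A)%:~R.
Definition glift g := qlift (qcplx g).
Definition qhalf A : quat R := qscal 2^-1 * qlift A.

Lemma qliftM A B : qlift (A * B) = qlift A * qlift B.
Proof.
case: A B => [a b c d] [a' b' c' d'].
rewrite /qlift !QuatE /=; by congr Quat; rewrite !(rmorphB, rmorphD) !rmorphM.
Qed.
Lemma qlift_conj A : qlift (qconj A) = qconj (qlift A).
Proof. by rewrite /qlift /qconj /= !rmorphN. Qed.
Lemma qlift_inj : injective qlift.
Proof. by case=> [? ? ? ?] [? ? ? ?] [] /intr_inj-> /intr_inj-> /intr_inj-> /intr_inj->. Qed.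
Lemma qlift_scal (c : int) : qlift (qscal c) = qscal c%:~R.
Proof. by []. Qed.
Lemma gliftM u g : glift (u * g) = glift u * glift g.
Proof. by rewrite /glift qcplxM qliftM. Qed.
Lemma glift_inj : injective glift.
Proof. by move=> x y /qlift_inj/qcplx_inj. Qed.
Lemma glift_eq0 g : (glift g == 0) = (g == 0).
Proof. exact: (inj_eq glift_inj g 0). Qed.

Lemma qscal_half2 (X : quat R) : qscal 2^-1 * (qscal 2 * X) = X.
Proof.
rewrite mulrA -qscalM mulVf ?pnatr_eq0 // [qscal 1](_ : _ = 1) ?mul1r //.
Qed.

Lemma qhalf_inj : injective qhalf.
Proof.
move=> A B /(congr1 (fun X => qscal 2 * X)).
rewrite /qhalf !mulrA -qscalM divff ?pnatr_eq0 // [qscal 1](_ : _ = 1) // !mul1r.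
exact: qlift_inj.
Qed.
Lemma qhalf_eq0 A : (qhalf A == 0) = (A == 0).
Proof.
rewrite -(inj_eq qhalf_inj) [qhalf 0](_ : _ = 0) //.
by rewrite /qhalf [qlift 0](_ : _ = 0) ?mulr0.
Qed.
Lemma qhalf_mul A g : qhalf (A * qcplx g) = qhalf A * glift g.
Proof. by rewrite /qhalf qliftM mulrA. Qed.

Lemma hurwitz_qhalf (alpha : quat R) :
  hurwitz alpha <-> exists2 A, same_parity A & alpha = qhalf A.
Proof.
split.
  case: alpha => a b c d [] [] /=.
    move=> /intrP[a' ->] /intrP[b' ->] /intrP[c' ->] /intrP[d' ->].
    exists (qscal 2 * Quat a' b' c' d').
      rewrite /qscal QuatE; exists (2 * a'), (b' - a'), (c' - a'), (d' - a').
      by congr Quat; ring.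
    by rewrite /qhalf qliftM qlift_scal qscal_half2.
  move=> [a' ->] [b' ->] [c' ->] [d' ->].
  exists (Quat (2 * a' + 1) (2 * b' + 1) (2 * c' + 1) (2 * d' + 1)).
    exists (2 * a' + 1), (b' - a'), (c' - a'), (d' - a').
    by congr Quat; ring.
  by rewrite /qhalf /qlift /qscal QuatE /=; congr Quat; rewrite !mul0r ?addr0 ?subr0 mulrC.
move=> [A [a [u [v [w ->]]]] ->].
have [a' [->|->]] := int_parity a.
  have -> : qhalf (Quat (2 * a') (2 * a' + 2 * u) (2 * a' + 2 * v) (2 * a' + 2 * w))
      = qlift (Quat a' (a' + u) (a' + v) (a' + w)).
    rewrite -[RHS]qscal_half2 -[qscal 2]/(qscal (2%:Z)%:~R) -qlift_scal -qliftM.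
    by congr qhalf; rewrite /qscal QuatE; congr Quat; ring.
  by left; rewrite /=; split; apply/intrP; eexists.
have h (n : int) : half_odd (2^-1 * (2 * a' + 1 + 2 * n)%:~R : R).
  by exists (a' + n); rewrite mulrC; congr (_%:~R / _); ring.
right; rewrite /qhalf /qlift /qscal QuatE /= !mul0r !(addr0, subr0); split => //.
by have := h 0; rewrite mulr0 addr0.
Qed.

Lemma gaussian_glift (z : quat R) : gaussian z <-> exists g, z = glift g.
Proof.
split; last first.
  by move=> [g ->]; split => //; apply/intrP; eexists.
case: z => a b c d [] /= /intrP[a' ->] /intrP[b' ->] -> ->.
by exists (Cplx a' b').
Qed.

Lemma qscal_quarter A B (X : quat R) : qhalf A * X * qconj (qhalf B) =
  qscal 4^-1 * (qlift A * X * qlift (qconj B)).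
Proof.
rewrite /qhalf qconjM -qlift_conj [qconj (qscal _)](_ : _ = qscal 2^-1); last first.
  by rewrite /qconj /= oppr0.
transitivity (qscal 2^-1 * (qlift A * X * qlift (qconj B)) * qscal 2^-1).
  by rewrite !mulrA.
by rewrite -qscalC mulrA -qscalM -invfM -natrM.
Qed.

Lemma qhalf_twj A g : qhalf A * glift g * qj * qconj (qhalf A) =
  qscal 4^-1 * qlift (twin_j A g).
Proof.
by rewrite -(mulrA (qhalf A)) qscal_quarter /twin_j !qliftM !mulrA.
Qed.
Lemma qhalf_twk A g : qhalf A * glift g * qk * qconj (qhalf A) =
  qscal 4^-1 * qlift (twin_k A g).
Proof.
by rewrite -(mulrA (qhalf A)) qscal_quarter /twin_k !qliftM !mulrA.
Qed.

Lemma qscal_quarter4 T : qscal 4^-1 * qlift (qscal 4 * T) = qlift T.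
Proof.
rewrite qliftM qlift_scal mulrA -qscalM mulVf ?pnatr_eq0 //.
by rewrite [qscal 1](_ : _ = 1) ?mul1r.
Qed.

Lemma parameterizedE A g (theta eta : quat R) :
  parameterized theta eta (qhalf A) (glift g) <->
  theta = qscal 4^-1 * qlift (twin_j A g) /\ eta = qscal 4^-1 * qlift (twin_k A g).
Proof.
by rewrite -qhalf_twj -qhalf_twk.
Qed.

Lemma equivalentP A1 g1 A2 g2 :
  equivalent (qhalf A1) (glift g1) (qhalf A2) (glift g2) <->
  twin_j A1 g1 = twin_j A2 g2 /\ twin_k A1 g1 = twin_k A2 g2.
Proof.
have inj4 A B : qscal 4^-1 * qlift A = qscal 4^-1 * qlift B -> A = B.
  move=> /(congr1 (fun X => qscal 4 * X)).
  rewrite !mulrA -qscalM divff ?pnatr_eq0 // [qscal 1](_ : _ = 1) // !mul1r.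
  exact: qlift_inj.
split=> [h|[ej ek] theta eta].
  (* The equivalence is tested on the pair that the first parameters yield. *)
  have /parameterizedE[ej ek] := (h _ _).1 ((parameterizedE A1 g1 _ _).2 (conj erefl erefl)).
  by split; apply: inj4.
by rewrite !parameterizedE ej ek.
Qed.

Lemma gdvdP u g : gdvd (glift u) (glift g) <-> exists c, g = u * c.
Proof.
split=> [[_ /gaussian_glift[c ->]]|[c ->]]; first by rewrite -gliftM => /glift_inj ->; exists c.
by exists (glift c); [apply/gaussian_glift; exists c | rewrite gliftM].
Qed.

Lemma cnorm_dvd1 u c : 1 = u * c -> cnorm u = 1.
Proof.
move=> /(congr1 (@cnorm _)); rewrite cnorm1 cnormM => e.
have : (cnorm u %| 1)%Z by apply/dvdzP; exists (cnorm c); rewrite mulrC -e.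
by have := cnorm_ge0 u; rewrite dvdz1; lia.
Qed.

(** A nonzero nonunit root of a square divisor has a prime factor, whose square also divides [g]. *)
Lemma gaussian_squarefreeP g : gaussian_squarefree (glift g) <-> gsquarefree g.
Proof.
split=> [h d c e|h p [/gaussian_glift[p' ->]] _ p1 _]; last first.
  rewrite expr2 -gliftM => /gdvdP[c e]; apply: p1.
  have p1 : cnorm p' = 1 by apply: (h p' c); rewrite expr2.
  by apply/(gdvdP p' 1); exists (cconj p'); rewrite mulccconj p1.
have key x : x != 0 -> cnorm x != 1 -> (exists c, g = x ^+ 2 * c) -> False.
  move=> x0 x1 [c' e'].
  have [p [q [ex p0 p1 hp]]] := gint_prime_factor x0 x1.
  apply: (h (glift p)); last first.
    by rewrite expr2 -gliftM; apply/gdvdP; exists (q * q * c'); rewrite e' ex; ring.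
  split; [by apply/gaussian_glift; exists p | by rewrite glift_eq0 | |].
    by move=> /(gdvdP p 1)[c1 /cnorm_dvd1/eqP]; rewrite (negPf p1).
  move=> _ _ /gaussian_glift[a ->] /gaussian_glift[b ->].
  rewrite -gliftM => /gdvdP[c1 /hp[h1|h1]]; [left|right]; exact/gdvdP.
(* If [d = 0] then [g = 0], and the nonunit 2 takes the place of [d]. *)
have [d0|d0] := eqVneq d 0.
  exfalso; apply: (key (creal 2)) => //; exists 0.
  by rewrite e d0 expr2 !mul0r mulr0.
by apply/eqP; apply: contraT => d1; case: (key _ d0 d1); exists c.
Qed.

Lemma gaussian_unitsP (rho : quat R) :
  rho \in [:: 1; -1; qi; - qi] <-> exists2 u, cnorm u = 1 & rho = glift u.
Proof.
have e1 : 1 = glift 1 by [].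
have eN1 : -1 = glift (-1) by rewrite /glift /qlift /= !Quat10 QuatN !oppr0.
have ei : qi = glift (Cplx 0 1) by [].
have eNi : - qi = glift (Cplx 0 (-1)) by rewrite /glift /qlift /= /qi QuatN !oppr0.
split; rewrite !inE.
  by case/or4P=> /eqP->; [exists 1|exists (-1)|exists (Cplx 0 1)|exists (Cplx 0 (-1))].
move=> [u /gint_unit + ->]; rewrite !inE => /or4P[]/eqP->.
- by rewrite -e1 eqxx.
- by rewrite -eN1 eqxx orbT.
- by rewrite -ei eqxx !orbT.
- by rewrite -eNi eqxx !orbT.
Qed.

Lemma dotv_qvec (x y : quat R) :
  dotv (qvec x) (qvec y) = q1 x * q1 y + q2 x * q2 y + q3 x * q3 y.
Proof. by rewrite /dotv !big_ord_recl big_ord0 !mxE /= addr0 addrA. Qed.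

Lemma lenv_qlift T : q0 T = 0 -> lenv (qvec (qlift T)) = Num.sqrt (qnorm T)%:~R.
Proof.
move=> T0; rewrite /lenv dotv_qvec /qlift /= -!intrM -!intrD /qnorm T0.
by congr (Num.sqrt _%:~R); ring.
Qed.

Lemma twins_qliftP (theta eta : quat R) : twins theta eta <->
  exists T E, [/\ theta = qlift T, eta = qlift E,
    q0 T = 0 /\ q0 E = 0,
    qnorm T != 0 /\ qnorm T = qnorm E &
    q1 T * q1 E + q2 T * q2 E + q3 T * q3 E = 0].
Proof.
have qvec_int x : q0 x = 0 -> qvec x \is a mxOver Num.int ->
    exists2 T, q0 T = 0 & x = qlift T.
  case: x => a b c d /= -> /mxOverP h.
  have := h 0 0; have := h 0 1; have := h 0 2; rewrite !mxE /=.
  by move=> /intrP[d' ->] /intrP[c' ->] /intrP[b' ->]; exists (Quat 0 b' c' d').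
have qvec0 T : q0 T = 0 -> (qvec (qlift T) == 0) = (qnorm T == 0).
  move=> T0; rewrite qnorm_eq0; apply/eqP/eqP => [/rowP h|->].
    have := h 0; have := h 1; have := h 2; rewrite !mxE /=.
    move=> /eqP; rewrite intr_eq0 => /eqP h3 /eqP; rewrite intr_eq0 => /eqP h2.
    move=> /eqP; rewrite intr_eq0 => /eqP h1.
    by move=> {h}; case: T T0 h1 h2 h3 => ? ? ? ? /= -> -> -> ->.
  by apply/rowP => i; rewrite !mxE; case: i => -[|[|[|//]]] /=.
split.
  move=> [pt pe [[it ie] [t0 e0] d l]].
  have [T T0 eT] := qvec_int _ pt it; have [E E0 eE] := qvec_int _ pe ie.
  exists T, E; rewrite eT eE in t0 d l *; split => //.
    rewrite -qvec0 //; split => //.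
    move: l; rewrite !lenv_qlift // => /eqP.
    by rewrite eqr_sqrt ?ler0z ?qnorm_ge0 // => /eqP/intr_inj.
  by move: d; rewrite dotv_qvec /= -!intrM -!intrD => /eqP; rewrite intr_eq0 => /eqP.
move=> [T [E [-> -> [T0 E0] [n0 nTE] d]]].
have pl X : q0 X = 0 -> pure (qlift X) by rewrite /pure /= => ->.
have io X : qvec (qlift X) \is a mxOver Num.int.
  apply/mxOverP => i j; rewrite !mxE; case: j => -[|[|[|//]]] /= _; exact: intr_int.
split; [exact: pl | exact: pl | split].
- by [].
- by rewrite !qvec0 // -nTE.
- by rewrite dotv_qvec /= -!intrM -!intrD d.
- by rewrite !lenv_qlift // nTE.
Qed.

Lemma parameterized_qlift A g (theta eta : quat R) : same_parity A ->
  parameterized theta eta (qhalf A) (glift g) ->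
  exists T E, [/\ theta = qlift T, eta = qlift E, q0 T = 0 /\ q0 E = 0,
    twin_j A g = qscal 4 * T & twin_k A g = qscal 4 * E].
Proof.
move=> hA /parameterizedE[-> ->].
have [T T0 eT] := same_parity_twj_int g hA.
have [E E0] := same_parity_twj_int (Cplx 0 1 * g) hA; rewrite twin_j_i => eE.
by exists T, E; rewrite eT eE !qscal_quarter4.
Qed.

Lemma qlift_parameterized A g T E :
  twin_j A g = qscal 4 * T -> twin_k A g = qscal 4 * E ->
  parameterized (qlift T) (qlift E) (qhalf A) (glift g).
Proof. by move=> ej ek; apply/parameterizedE; rewrite ej ek !qscal_quarter4. Qed.
End Lift.

(** * The four claims over the reals *)

Section Parameterization.
Variable R : realType.
Implicit Types (theta eta alpha z : quat R).

Lemma twins_parameterized theta eta : twins theta eta <->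
  exists alpha z : quat R, [/\ hurwitz alpha, gaussian z, alpha != 0, z != 0
    & parameterized theta eta alpha z].
Proof.
split.
  move=> /twins_qliftP[T [E [-> -> [T0 E0] [n0 nTE] d]]].
  have [A [w [hA eT eE]]] := twins_parameterization T0 E0 n0 nTE d.
  have : qnorm (twin_j A w) != 0 by rewrite eT qnormM qnorm_scal mulf_neq0.
  rewrite qnorm_twj mulf_eq0 expf_eq0 /= negb_or qnorm_eq0 cnorm_eq0 => /andP[A0 w0].
  exists (qhalf R A), (glift R w).
  split; rewrite ?qhalf_eq0 ?glift_eq0 //; last exact: qlift_parameterized.
    by apply/hurwitz_qhalf; exists A.
  by apply/gaussian_glift; exists w.
move=> [_ [_ [/hurwitz_qhalf[A hA ->] /gaussian_glift[g ->]]]].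
rewrite qhalf_eq0 glift_eq0 => A0 g0 /(parameterized_qlift hA).
move=> [T [E [-> -> [T0 E0] eT eE]]]; apply/twins_qliftP; exists T, E.
have nT : 16 * qnorm T = qnorm A ^+ 2 * cnorm g by rewrite -qnorm_twj eT qnormM qnorm_scal.
have nE : 16 * qnorm E = qnorm A ^+ 2 * cnorm g by rewrite -qnorm_twk eE qnormM qnorm_scal.
split=> //.
  split; last by apply: (@mulfI _ 16); rewrite // nT nE.
  apply/eqP => h; move/esym/eqP: nT; rewrite h mulr0 mulf_eq0 expf_eq0 /=.
  by rewrite qnorm_eq0 cnorm_eq0 (negPf A0) (negPf g0).
(* Orthogonality: the real part of [4T * 4E] is -16 times the dot product, and it vanishes because
   [A * qi * qconj A] is pure. *)
have := congr1 (@q0 int) (twin_j_mul_twin_k A g); rewrite eT eE.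
case: T E T0 E0 {eT eE nT nE} => a b c d [a' b' c' d'] /= -> -> h.
apply: (@mulfI _ (-16)) => //; rewrite mulr0.
transitivity (q0 (qscal 4 * Quat 0 b c d * (qscal 4 * Quat 0 b' c' d'))).
  by rewrite /qscal !QuatE /=; ring.
transitivity (q0 (qscal (qnorm A * cnorm g) * (A * qi * qconj A))).
  exact: h.
case: A {hA A0 h} => ? ? ? ?; set k := _ * _.
by rewrite /qi /qconj /qscal /= ?QuatE /=; ring.
Qed.

Lemma equivalent_squarefree alpha z : hurwitz alpha -> gaussian z ->
  exists alpha' z' : quat R,
    [/\ hurwitz alpha', gaussian z', gaussian_squarefree z' & equivalent alpha z alpha' z'].
Proof.
move=> /hurwitz_qhalf[A hA ->] /gaussian_glift[g ->].
have [A' [g' [hA' sg' ej ek]]] := squarefree_reparameterization g hA.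
exists (qhalf R A'), (glift R g'); split.
- by apply/hurwitz_qhalf; exists A'.
- by apply/gaussian_glift; exists g'.
- exact/gaussian_squarefreeP.
- exact/equivalentP.
Qed.

(** Pairs with first component 0 all parameterize [(0, 0)], whatever [z] is; hence the exclusion of
    [alpha1 = alpha2 = 0]. *)
Lemma equivalent_unit alpha1 z1 alpha2 z2 :
  hurwitz alpha1 -> gaussian z1 -> hurwitz alpha2 -> gaussian z2 ->
  gaussian_squarefree z1 -> gaussian_squarefree z2 ->
  ~ (alpha1 = 0 /\ alpha2 = 0) ->
  (equivalent alpha1 z1 alpha2 z2 <->
   exists2 rho : quat R, rho \in [:: 1; -1; qi; - qi]
     & alpha2 = alpha1 * rho /\ z2 = rho ^+ 2 * z1).
Proof.
move=> /hurwitz_qhalf[A1 h1 ->] /gaussian_glift[g1 ->].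
move=> /hurwitz_qhalf[A2 h2 ->] /gaussian_glift[g2 ->].
move=> /gaussian_squarefreeP s1 /gaussian_squarefreeP s2 nz.
split; last first.
  move=> [_ /gaussian_unitsP[u u1 ->] []].
  rewrite -qhalf_mul expr2 -!gliftM => /qhalf_inj-> /glift_inj->.
  by apply/equivalentP; rewrite twin_j_mul twin_k_mul mulrA gint_unit4 ?mul1r.
move=> /equivalentP[ej ek].
(* If [A1 = 0], the twins vanish; since [g2] is nonzero, [A2 = 0] as well. *)
have A10 : A1 != 0.
  apply/eqP => A10; apply: nz; rewrite A10; move: ej; rewrite A10 /twin_j !mul0r.
  move=> /(congr1 (@qnorm int)); rewrite -/(twin_j A2 g2) qnorm_twj.
  rewrite [qnorm 0](_ : _ = 0) // => /esym/eqP; rewrite mulf_eq0 cnorm_eq0.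
  rewrite (negPf (gsquarefree_neq0 s2)) orbF expf_eq0 /= qnorm_eq0 => /eqP->.
  by split; apply/eqP; rewrite qhalf_eq0.
have [u [u1 eA eg]] := parameterization_unique A10 s2 s1 (esym ej) (esym ek).
exists (glift R u); first by apply/gaussian_unitsP; exists u.
split; first by rewrite eA qhalf_mul.
by rewrite expr2 -!gliftM eg mulrA gint_unit4 // mul1r.
Qed.

Lemma integer_length theta eta alpha z : twins theta eta ->
  hurwitz alpha -> gaussian z -> gaussian_squarefree z ->
  parameterized theta eta alpha z ->
  (lenv (qvec theta) \is a Num.int <-> real_quat z \/ imaginary_quat z).
Proof.
move=> tw /hurwitz_qhalf[A hA ->] /gaussian_glift[g ->] /gaussian_squarefreeP sg.
move=> /(parameterized_qlift hA)[T [E [eT _ [T0 _] ej _]]].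
have n0 : qnorm T != 0.
  move: tw => /twins_qliftP[T' [E' [eT' _ _ [n0 _] _]]].
  by rewrite eT in eT'; rewrite (qlift_inj eT').
have [k hk] := qnorm_same_parity hA.
(* Here [k] is the norm of [alpha], so the squared length is a square times the norm of [z]. *)
have nT : qnorm T = k ^+ 2 * cnorm g.
  apply: (@mulfI _ 16) => //; transitivity (qnorm (twin_j A g)).
    by rewrite ej qnormM qnorm_scal.
  by rewrite qnorm_twj hk; ring.
have k0 : k != 0 by apply: contraNneq n0 => k0; rewrite nT k0 expr0n mul0r.
have -> : real_quat (glift R g) \/ imaginary_quat (glift R g) <-> cre g = 0 \/ cim g = 0.
  split=> [[[h _ _]|[h _ _]]|[h|h]]; [right|left|right|left].
  - by apply/eqP; rewrite -(intr_eq0 R); apply/eqP.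
  - by apply/eqP; rewrite -(intr_eq0 R); apply/eqP.
  - by split; rewrite //= h.
  - by split; rewrite //= h.
rewrite eT lenv_qlift //; split.
  move=> /intrP[l hl]; apply: (squarefree_square_norm (l := l) sg k0).
  rewrite -nT; apply: (@intr_inj R); rewrite rmorphXn /= -hl sqr_sqrtr //.
  by rewrite ler0z qnorm_ge0.
have hs (l : int) : qnorm T = l ^+ 2 -> Num.sqrt (qnorm T)%:~R \is a @Num.int R.
  by move=> ->; rewrite rmorphXn /= sqrtr_sqr -intr_norm; apply/intrP; eexists.
rewrite /cnorm in nT; case=> h; rewrite h in nT.
  by apply: (hs (k * cim g)); rewrite nT; ring.
by apply: (hs (k * cre g)); rewrite nT; ring.
Qed.
End Parameterization.

Theorem theorem5p4 (R : realType) :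
  [/\ (forall theta eta : quat R, pure theta -> pure eta ->
         (twins theta eta <->
          exists alpha z : quat R,
            [/\ hurwitz alpha, gaussian z, alpha != 0, z != 0
              & parameterized theta eta alpha z])),
      (forall alpha z : quat R, hurwitz alpha -> gaussian z ->
         exists alpha' z' : quat R,
           [/\ hurwitz alpha', gaussian z', gaussian_squarefree z'
             & equivalent alpha z alpha' z']),
      (forall alpha1 z1 alpha2 z2 : quat R,
         hurwitz alpha1 -> gaussian z1 -> hurwitz alpha2 -> gaussian z2 ->
         gaussian_squarefree z1 -> gaussian_squarefree z2 ->
         ~ (alpha1 = 0 /\ alpha2 = 0) ->
         (equivalent alpha1 z1 alpha2 z2 <->
          exists2 rho : quat R, rho \in [:: 1; -1; qi; - qi]
            & alpha2 = alpha1 * rho /\ z2 = rho ^+ 2 * z1))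
    & (forall theta eta : quat R, twins theta eta ->
         forall alpha z : quat R,
           hurwitz alpha -> gaussian z -> gaussian_squarefree z ->
           parameterized theta eta alpha z ->
           (lenv (qvec theta) \is a Num.int <->
            real_quat z \/ imaginary_quat z))].
Proof.
split.
- by move=> theta eta _ _; exact: twins_parameterized.
- exact: equivalent_squarefree.
- exact: equivalent_unit.
- by move=> theta eta tw alpha z; exact: integer_length.
Qed.
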